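(* Let $n\geq 4$. Among all simple strongly connected digraphs on $n$ vertices, $\theta(0,1,n-3)$, $\theta(1,1,n-4)$ and $\theta(0,2,n-4)$ are (up to isomorphism) the digraphs which achieve the second, the third and the fourth minimum spectral radius, respectively. That is, with $\overrightarrow{C_n}$ the directed cycle on $n$ vertices, $$\rho(\overrightarrow{C_n})<\rho(\theta(0,1,n-3))<\rho(\theta(1,1,n-4))<\rho(\theta(0,2,n-4))<\rho(D)$$ for every simple strongly connected digraph $D$ on $n$ vertices not isomorphic to any of these four digraphs.
   Context: Digraphs are finite and simple (no loops, no multiple arcs; opposite arcs allowed). $\rho(D)$ is the spectral radius (largest modulus of an eigenvalue) of the adjacency matrix $A(D)$. $\theta(a,b,c)$ denotes the digraph on $a+b+c+2$ vertices consisting of three directed paths $P_{a+2},P_{b+2},P_{c+2}$ (with $a+2$, $b+2$, $c+2$ vertices, respectively), sharing only their end vertices, such that $P_{a+2}$ and $P_{b+2}$ both start at a vertex $p$ and end at a vertex $r\neq p$, while $P_{c+2}$ starts at $r$ and ends at $p$. *)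

(* Defs.v *)
From mathcomp Require Import all_boot all_order all_algebra.
From mathcomp Require Import all_classical all_reals.
From mathcomp Require Import complex.

Set Implicit Arguments.
Unset Strict Implicit.
Unset Printing Implicit Defensive.

Import Order.TTheory GRing.Theory Num.Theory.

Local Open Scope ring_scope.

(* A digraph is given by its arc relation D : rel V on a finite vertex type V;
   a relation cannot have multiple arcs, so simple means loopless. *)
Definition simple_digraph (V : finType) (D : rel V) : Prop := irreflexive D.

Definition strongly_connected (V : finType) (D : rel V) : Prop :=
  forall x y : V, connect D x y.

Definition simple_strong_digraph (n : nat) (V : finType) (D : rel V) : Prop :=
  [/\ #|V| = n, simple_digraph D & strongly_connected D].

Definition digraph_iso (V W : finType) (D : rel V) (E : rel W) : Prop :=
  exists2 f : V -> W, bijective f & forall x y, E (f x) (f y) = D x y.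

Definition adjacency_mx (K : nzRingType) (V : finType) (D : rel V) :
    'M[K]_#|V| :=
  \matrix_(i, j) (D (enum_val i) (enum_val j))%:R.

Definition spectral_radius (R : realType) (m : nat) (A : 'M[R[i]]_m) : R :=
  sup [set Normc.normc z | z in [set z : R[i] | eigenvalue A z]].

(* The supremum is a maximum. *)
Lemma spectral_radius_max (R : realType) (m : nat) (A : 'M[R[i]]_m) :
  (0 < m)%N ->
  (exists2 z, eigenvalue A z & Normc.normc z = spectral_radius A) /\
  (forall z, eigenvalue A z -> Normc.normc z <= spectral_radius A).
Proof.
move=> m_gt0; set nc := @Normc.normc R.
have [s Ds] := closed_field_poly_normal (char_poly A).
have memP z : eigenvalue A z = (z \in s).
  rewrite eigenvalue_root_char Ds rootZ ?root_prod_XsubC //.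
  by rewrite lead_coef_eq0 monic_neq0 // char_poly_monic.
have [z0 z0s] : exists z, z \in s.
  case: s Ds {memP} => [|z s] Ds; last by exists z; rewrite mem_head.
  have := size_char_poly A; rewrite Ds big_nil alg_polyC => sz.
  by have := size_polyC_leq1 (lead_coef (char_poly A)); rewrite sz ltnNge m_gt0.
have [z zs zmax] : exists2 z, z \in s & forall y, y \in s -> nc y <= nc z.
  elim: s z0 z0s {Ds memP} => // a [|b s] IHs z0 _.
    by exists a; rewrite ?mem_head // => y; rewrite inE => /eqP->.
  have [z zs zmax] := IHs b (mem_head _ _).
  have [le_za | lt_az] := leP (nc z) (nc a).
    exists a; rewrite ?mem_head // => y; rewrite inE => /predU1P[-> //|/zmax].
    by move/le_trans; apply.
  exists z; first by rewrite inE zs orbT.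
  by move=> y; rewrite inE => /predU1P[->|/zmax //]; apply: ltW.
have -> : spectral_radius A = nc z.
  apply/eqP; rewrite eq_le; apply/andP; split.
    apply: ge_sup; first by exists (nc z); exists z; rewrite //= memP.
    by move=> _ [y /= Ay <-]; apply: zmax; rewrite -memP.
  apply: ub_le_sup; last by exists z; rewrite //= memP.
  by exists (nc z) => _ [y /= Ay <-]; apply: zmax; rewrite -memP.
by split=> [|y]; [exists z; rewrite ?memP | rewrite memP; apply: zmax].
Qed.

Definition rho (R : realType) (V : finType) (D : rel V) : R :=
  spectral_radius (adjacency_mx R[i] D).

(* For n = 1 this is a loop; it is used for n >= 2. *)
Definition dicycle (n : nat) : rel 'I_n :=
  fun i j => (j : nat) == (i.+1 %% n)%N.

Definition path_arcs (s : seq nat) : seq (nat * nat) := zip s (behead s).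

(* theta(a,b,c), with p numbered 0, the internal vertices of the first path
   1, ..., a, then r numbered a + 1, then the internal vertices of the second
   path, then those of the third. For a = b = 0 the two arcs from p to r would
   be identified; the digraph is not used in that case. *)
Definition theta (a b c : nat) : rel 'I_(a + b + c + 2) :=
  let p := 0%N in
  let r := a.+1 in
  let P1 := p :: iota 1 a ++ [:: r] in
  let P2 := p :: iota (a + 2) b ++ [:: r] in
  let P3 := r :: iota (a + b + 2) c ++ [:: p] in
  fun u v => ((u : nat), (v : nat))
               \in path_arcs P1 ++ path_arcs P2 ++ path_arcs P3.

Arguments dicycle n : clear implicits.
Arguments theta a b c : clear implicits.

(* Main.v *)
Require Import Defs.
From mathcomp Require Import all_boot all_order all_algebra.
From mathcomp Require Import all_classical all_reals.
From mathcomp Require Import complex.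
From mathcomp Require Import zify ring lra.

(** A positive weight w on the vertices whose sum over the out-neighbours of
    each vertex x is at least t w(x) forces rho >= t, strictly if the digraph is
    strong and the inequality is strict somewhere.  Fix a vertex p and take
    w(x) = s^d(x), with d(x) the distance from x to p and s = 1/t: the condition
    then holds at every x <> p, and at p it says that the sum of s^(d(q)+1) over
    the out-neighbours q of p is at least 1.  For theta(0,1,n-3),
    theta(1,1,n-4) and theta(0,2,n-4) all these are equalities, with
    s^n + s^(n-1) = 1, 2 s^(n-1) = 1 and s^n + s^(n-2) = 1 respectively.

    Let t = rho(theta(0,2,n-4)).  If a vertex p of D has two out-neighbours, one
    of them at distance at most n-3 from p, then the condition holds at p since
    distances are at most n-1, and equality everywhere forces
    D = theta(0,2,n-4).  Otherwise the out-neighbours of every branching vertex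
    p lie at distance n-2 or n-1 from p, so the distance layers are almost all
    singletons, and D is a directed cycle, theta(0,1,n-3), theta(1,1,n-4), or
    contains theta(0,1,n-3) with one specific additional arc, and then another
    weight gives rho > t. *)

Set Implicit Arguments.
Unset Strict Implicit.
Unset Printing Implicit Defensive.

Import Order.TTheory GRing.Theory Num.Theory.

Local Open Scope ring_scope.

(** * Bounds on the spectral radius from weights *)

Lemma one_plus_natmul_le_expr (R : realDomainType) (x : R) (k : nat) :
  0 <= x -> 1 + x *+ k <= (1 + x) ^+ k.
Proof.
move=> x_ge0; elim: k => [|k IHk]; first by rewrite mulr0n addr0 expr0.
rewrite exprS mulrDl mul1r mulrS [x + _]addrC addrA lerD //.
by rewrite ler_peMr // exprn_ege1 // lerDl.
Qed.

Lemma expr_unbounded (R : archiRealFieldType) (q c : R) :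
  1 < q -> exists k, c < q ^+ k.
Proof.
move=> q_gt1; have d_gt0 : 0 < q - 1 by rewrite subr_gt0.
exists (Num.bound (`|c| / (q - 1))).
apply: le_lt_trans (ler_norm c) _.
have /archi_boundP : 0 <= `|c| / (q - 1) by rewrite divr_ge0 // ltW.
rewrite ltr_pdivrMr // mulr_natl => /lt_le_trans; apply.
have := one_plus_natmul_le_expr (Num.bound (`|c| / (q - 1))) (ltW d_gt0).
rewrite [1 + (q - 1)]addrC subrK; apply: le_trans.
by rewrite lerDr ler01.
Qed.

(** Induction on the roots: peeling off [z] leaves v = (A - z) w, which the remaining factors kill,
    and A^(k+1) w = A^k v + z A^k w carries the bound for [v] over to [w]. *)
Lemma expr_mulmx_growth (C : numFieldType) (m : nat) (A : 'M[C]_m.+1)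
    (s : seq C) (r : C) (w : 'cV[C]_m.+1) :
    0 <= r -> {in s, forall z, `|z| < r} ->
    horner_mx A (\prod_(z <- s) ('X - z%:P)) *m w = 0 ->
  exists2 c, 0 <= c & forall k i, `|(A ^+ k *m w) i 0| <= c * r ^+ k.
Proof.
move=> r_ge0; elim: s w => [|z s IHs] w sr.
  rewrite big_nil rmorph1 mul1mx => ->.
  by exists 0 => // k i; rewrite mulmx0 mxE normr0 mul0r.
have zr : `|z| < r by rewrite sr ?mem_head.
rewrite big_cons mulrC rmorphM /= -mulmxA => /IHs[|c c_ge0 bnd].
  by move=> y ys; rewrite sr // inE ys orbT.
have rz_gt0 : 0 < r - `|z| by rewrite subr_gt0.
pose c0 := \sum_i `|w i 0|.
have c0_ge0 : 0 <= c0 by apply: sumr_ge0.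
(* [c0] covers [k = 0]; the second summand gives c + |z| c' <= c' r for the new constant c', as the
   recursion requires. *)
exists (c0 + c / (r - `|z|)); first by rewrite addr_ge0 // divr_ge0 // ltW.
have c'P : c <= (c0 + c / (r - `|z|)) * (r - `|z|).
  by rewrite mulrDl divfK ?gt_eqF // lerDr mulr_ge0 // ltW.
elim=> [|k IHk] i.
  rewrite expr0 mul1mx mulr1 /c0 (bigD1 i) //= -addrA lerDl.
  by rewrite addr_ge0 ?sumr_ge0 // divr_ge0 // ltW.
have -> : A ^+ k.+1 *m w =
    A ^+ k *m (horner_mx A ('X - z%:P) *m w) + z *: (A ^+ k *m w).
  rewrite rmorphB /= horner_mx_X horner_mx_C mulmxBl mulmxBr mul_scalar_mx.
  by rewrite -scalemxAr subrK mulmxA -[A ^+ k *m A]/(A ^+ k * A) -exprSr.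
rewrite mxE; apply: le_trans (ler_normD _ _) _.
rewrite [in X in _ + X <= _]mxE normrM.
apply: le_trans (lerD (bnd k i) (ler_wpM2l (normr_ge0 z) (IHk i))) _.
rewrite exprS !mulrA -mulrDl ler_wpM2r ?exprn_ge0 //.
by rewrite -lerBrDr [`|z| * _]mulrC -mulrBr.
Qed.

(** A Collatz-Wielandt bound without Perron-Frobenius theory: for r strictly between the radius and
    [lam], Cayley-Hamilton and the growth lemma give A^k w = O(r^k), whereas nonnegativity gives A^k
    w >= lam^k w. *)
Lemma spectral_radius_ge (R : realType) (m : nat) (A : 'M[R[i]]_m)
    (w : 'cV[R[i]]_m) (lam : R) :
    (forall i j, 0 <= A i j) -> (forall i, 0 <= w i 0) -> w != 0 ->
    0 <= lam -> (forall i, lam%:C%C * w i 0 <= (A *m w) i 0) ->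
  lam <= spectral_radius A.
Proof.
case: m A w => [|m] A w A_ge0 w_ge0 w_neq0 lam_ge0 Aw.
  by rewrite (flatmx0 w) eqxx in w_neq0.
have [[z0 _ rho_z0] rho_max] := @spectral_radius_max R _ A isT.
rewrite leNgt; apply/negP => rho_lt.
set rho := spectral_radius A in rho_z0 rho_max rho_lt.
have normE (z : R[i]) : `|z| = (Normc.normc z)%:C%C by [].
have rho_ge0 : 0 <= rho.
  by rewrite -rho_z0 -lecR -normE normr_ge0.
pose r := (rho + lam) / 2.
have r_gt : rho < r by rewrite /r; lra.
have r_lt : r < lam by rewrite /r; lra.
have r_gt0 : 0 < r by lra.
have [s Ds] := closed_field_poly_normal (char_poly A).
have sr : {in s, forall z, `|z| < r%:C%C}.
  move=> z zs; rewrite normE ltcR; apply: le_lt_trans r_gt; apply: rho_max.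
  rewrite eigenvalue_root_char Ds rootZ ?root_prod_XsubC //.
  by rewrite lead_coef_eq0 monic_neq0 // char_poly_monic.
have [||c c_ge0 bnd] := expr_mulmx_growth (w := w) (A := A) _ sr.
- by rewrite lecR ltW.
- move: Ds; rewrite (monicP (char_poly_monic A)) scale1r => <-.
  by rewrite Cayley_Hamilton mul0mx.
have growth k i : lam%:C%C ^+ k * w i 0 <= (A ^+ k *m w) i 0.
  elim: k i => [|k IHk] i; first by rewrite mul1r mul1mx.
  rewrite exprSr -mulrA.
  apply: le_trans (_ : lam%:C%C ^+ k * (A *m w) i 0 <= _).
    by rewrite ler_wpM2l // exprn_ge0 // lecR.
  rewrite exprS -mulmxA !mxE mulr_sumr; apply: ler_sum => j _.
  by rewrite mulrCA ler_wpM2l.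
have /cV0Pn[i wi_neq0] := w_neq0.
have wi_gt0 : 0 < w i 0 by rewrite lt0r wi_neq0 w_ge0.
have cR : c = (Normc.normc c)%:C%C by rewrite -normE ger0_norm.
have wR : w i 0 = (Normc.normc (w i 0))%:C%C by rewrite -normE ger0_norm.
have [|k] := @expr_unbounded R (lam / r)
    (Normc.normc c / Normc.normc (w i 0)) _.
  by rewrite ltr_pdivlMr // mul1r.
have wi_gt0' : 0 < Normc.normc (w i 0) by rewrite -ltcR -wR.
rewrite expr_div_n ltr_pdivrMr // mulrAC ltr_pdivlMr ?exprn_gt0 // ltNge.
apply/negP; rewrite negbK -lecR !rmorphM !rmorphXn /= -wR -cR.
apply: le_trans (bnd k i); apply: le_trans (growth k i) _.
apply/real_ler_norm/ger0_real/le_trans/(growth k i).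
by rewrite mulr_ge0 // exprn_ge0 // lecR.
Qed.

(** Pair [w] with the moduli |u| of a left eigenvector for an eigenvalue [z] of largest modulus: |z|
    |u|w <= |u|Aw <= lam |u|w, and |u|w is positive. *)
Lemma spectral_radius_le (R : realType) (m : nat) (A : 'M[R[i]]_m)
    (w : 'cV[R[i]]_m) (lam : R) :
    (0 < m)%N -> (forall i j, 0 <= A i j) -> (forall i, 0 < w i 0) ->
    (forall i, (A *m w) i 0 <= lam%:C%C * w i 0) ->
  spectral_radius A <= lam.
Proof.
move=> m_gt0 A_ge0 w_gt0 Aw.
have [[z Az <-] _] := @spectral_radius_max R _ A m_gt0.
have /eigenvalueP[u uA /rV0Pn[j0 uj0]] := Az.
rewrite -lecR -[X in X <= _]/(`|z|).
have S_gt0 : 0 < \sum_j `|u 0 j| * w j 0.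
  rewrite (bigD1 j0) //= ltr_wpDr ?mulr_gt0 ?normr_gt0 //.
  by apply: sumr_ge0 => j _; rewrite mulr_ge0 // ltW.
rewrite -(ler_pM2r S_gt0) !mulr_sumr.
apply: le_trans (_ : \sum_j (\sum_i `|u 0 i| * A i j) * w j 0 <= _).
  apply: ler_sum => j _; rewrite mulrA ler_wpM2r ?(ltW (w_gt0 j)) //.
  have -> : `|z| * `|u 0 j| = `|(u *m A) 0 j| by rewrite uA mxE normrM.
  rewrite mxE; apply: le_trans (ler_norm_sum _ _ _) _.
  by apply: ler_sum => i _; rewrite normrM (ger0_norm (A_ge0 _ _)).
under eq_bigr do rewrite mulr_suml.
rewrite exchange_big /=; apply: ler_sum => i _.
have -> : \sum_j `|u 0 i| * A i j * w j 0 = `|u 0 i| * (A *m w) i 0.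
  by rewrite mxE mulr_sumr; apply: eq_bigr => j _; rewrite mulrA.
by rewrite mulrCA ler_wpM2l.
Qed.

Lemma adjacency_mx_mulE (R : realType) (V : finType) (D : rel V) (w : V -> R)
    (i : 'I_#|V|) :
  (adjacency_mx R[i] D *m (\col_j (w (enum_val j))%:C%C)) i 0 =
  (\sum_(y | D (enum_val i) y) w y)%:C%C.
Proof.
rewrite mxE rmorph_sum /= [RHS]big_mkcond.
rewrite [RHS](reindex (fun j : 'I_#|V| => enum_val j)) /=; last first.
  by exists enum_rank => y _; [apply: enum_valK | apply: enum_rankK].
by apply: eq_bigr => j _; rewrite !mxE; case: (D _ _); rewrite ?mul1r ?mul0r.
Qed.

Lemma rho_ge (R : realType) (V : finType) (D : rel V) (w : V -> R) (lam : R) :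
    (forall x, 0 <= w x) -> (exists x, w x != 0) -> 0 <= lam ->
    (forall x, lam * w x <= \sum_(y | D x y) w y) ->
  lam <= rho R D.
Proof.
move=> w_ge0 [x wx] lam_ge0 Dw.
apply: (@spectral_radius_ge _ _ _ (\col_j (w (enum_val j))%:C%C)) => //.
- by move=> i j; rewrite mxE ler0n.
- by move=> i; rewrite mxE lecR.
- apply/cV0Pn; exists (enum_rank x); rewrite mxE enum_rankK.
  by apply: contra wx => /eqP[->].
- by move=> i; rewrite adjacency_mx_mulE mxE -rmorphM /= lecR.
Qed.

Lemma rho_le (R : realType) (V : finType) (D : rel V) (w : V -> R) (lam : R) :
    (0 < #|V|)%N -> (forall x, 0 < w x) ->
    (forall x, \sum_(y | D x y) w y <= lam * w x) ->
  rho R D <= lam.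
Proof.
move=> V_gt0 w_gt0 Dw.
apply: (@spectral_radius_le _ _ _ (\col_j (w (enum_val j))%:C%C)) => //.
- by move=> i j; rewrite mxE ler0n.
- by move=> i; rewrite mxE ltcR.
- by move=> i; rewrite adjacency_mx_mulE mxE -rmorphM /= lecR.
Qed.

(** * Distance to a vertex *)

Section Distance.

Variables (V : finType) (D : rel V).
Hypothesis D_sc : strongly_connected D.

Fixpoint reaches (p : V) (k : nat) (x : V) : bool :=
  if k is k'.+1 then [exists y, D x y && reaches p k' y] else x == p.

Lemma ex_reaches p x : exists k, reaches p k x.
Proof.
have /connectP[s] := D_sc x p.
elim: s x => [x _ ->|y s IHs x /=]; first by exists 0%N => /=.
case/andP=> xy ys p_last; have [k yk] := IHs y ys p_last; exists k.+1 => /=.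
by apply/existsP; exists y; rewrite xy.
Qed.

(** The target comes first: distances run from [x] to [p]. *)
Definition dist (p x : V) : nat := ex_minn (ex_reaches p x).

Lemma reaches_dist p x : reaches p (dist p x) x.
Proof. by rewrite /dist; case: ex_minnP. Qed.

Lemma dist_min p x k : reaches p k x -> (dist p x <= k)%N.
Proof. by rewrite /dist; case: ex_minnP => d _ d_min /d_min. Qed.

Lemma distxx p : dist p p = 0%N.
Proof. by apply/eqP; rewrite -leqn0 dist_min /=. Qed.

Lemma dist_eq0 p x : (dist p x == 0%N) = (x == p).
Proof.
apply/eqP/eqP => [d0|->]; last exact: distxx.
by have := reaches_dist p x; rewrite d0 => /eqP.
Qed.

Lemma dist_gt0 p x : (0 < dist p x)%N = (x != p).
Proof. by rewrite lt0n dist_eq0. Qed.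

Lemma dist_arc p x y : D x y -> (dist p x <= (dist p y).+1)%N.
Proof.
move=> xy; apply: dist_min => /=; apply/existsP; exists y.
by rewrite xy reaches_dist.
Qed.

Lemma dist_next p x : x != p -> exists2 y, D x y & dist p x = (dist p y).+1.
Proof.
rewrite -dist_gt0; have := reaches_dist p x.
case Ed: (dist p x) => [|k] //= /existsP[y /andP[xy yk]] _.
exists y => //; apply/eqP; rewrite eqSS eqn_leq dist_min // andbT.
by rewrite -ltnS -Ed dist_arc.
Qed.

Lemma dist_surj p x j : (j <= dist p x)%N -> exists y, dist p y = j.
Proof.
have [k dx] : exists k, dist p x = k by exists (dist p x).
elim: k x dx => [|k IHk] x dx; rewrite dx.
  by rewrite leqn0 => /eqP->; exists x.
rewrite leq_eqVlt => /predU1P[->|]; first by exists x.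
have [|y _] := @dist_next p x; first by rewrite -dist_gt0 dx.
by rewrite dx ltnS => -[/esym dy]; rewrite -dy; apply: IHk.
Qed.

Lemma dist_lt_card p x : (dist p x < #|V|)%N.
Proof.
have /choice[h hP] : forall j : 'I_(dist p x).+1, exists y, dist p y = j.
  by move=> j; apply: dist_surj (leq_ord j).
rewrite -[leqLHS]card_ord; apply: (@leq_card _ _ h) => i j hij.
by apply: val_inj; rewrite /= -!hP hij.
Qed.

(* A geodesic from x to p that goes through the level of z goes through z. *)
Lemma dist_le_sub p x z : (forall y, dist p y = dist p z -> y = z) ->
  (dist p z <= dist p x)%N -> (dist z x <= dist p x - dist p z)%N.
Proof.
move=> z_alone; have [k dx] : exists k, dist p x = k by exists (dist p x).
elim: k x dx => [|k IHk] x dx; rewrite dx.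
  rewrite leqn0 sub0n => /eqP dz0.
  by rewrite (z_alone x) ?distxx // dx dz0.
rewrite leq_eqVlt => /predU1P[dz|].
  by rewrite (z_alone x) ?distxx // dx dz.
rewrite ltnS => dz_le; have [|y xy] := @dist_next p x.
  by rewrite -dist_gt0 dx.
rewrite dx => -[/esym dy]; have := IHk y dy; rewrite dy => /(_ dz_le).
by rewrite subSn // -ltnS; apply: leq_trans; apply: dist_arc.
Qed.

End Distance.

(** A choice of one vertex per label is an injection between sets of size [n], hence a bijection
    inverse to [f]. Labellings below are thus only checked to be surjective. *)
Lemma surjective_label (V : finType) (n : nat) (f : V -> nat) :
    #|V| = n -> (forall j, (j < n)%N -> exists x, f x = j) ->
  injective f /\ forall x, (f x < n)%N.
Proof.
move=> <- f_surj.
have /choice[h hP] : forall j : 'I_#|V|, exists x, f x = j.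
  by move=> j; apply: f_surj.
have h_inj : injective h by move=> i j hij; apply: val_inj; rewrite /= -!hP hij.
have [h' h'K hK] := inj_card_bij h_inj (eq_leq (esym (card_ord _))).
split=> [x y|x]; last by rewrite -[x]hK hP.
by rewrite -[x]hK -[y]hK !hP => /val_inj->.
Qed.

Lemma iso_of_labels (V W : finType) (D : rel V) (E : rel W) (n : nat)
    (P : rel nat) (f : V -> nat) (g : W -> nat) :
    #|V| = n -> #|W| = n ->
    (forall j, (j < n)%N -> exists x, f x = j) ->
    (forall j, (j < n)%N -> exists u, g u = j) ->
    (forall x y, D x y = P (f x) (f y)) ->
    (forall u v, E u v = P (g u) (g v)) ->
  digraph_iso D E.
Proof.
move=> Vn Wn f_surj g_surj DP EP.
have [f_inj f_lt] := surjective_label Vn f_surj.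
have /choice[h hP] : forall x, exists u, g u = f x.
  by move=> x; apply: g_surj.
exists h; last by move=> x y; rewrite EP !hP DP.
apply: inj_card_bij; last by rewrite Vn Wn.
by move=> x y hxy; apply: f_inj; rewrite -!hP hxy.
Qed.

(** * Strict lower bounds from positive weights *)

Lemma rho_gt_all (R : realType) (V : finType) (D : rel V) (w : V -> R)
    (lam : R) (x0 : V) :
    (forall x, 0 < w x) -> 0 <= lam ->
    (forall x, lam * w x < \sum_(y | D x y) w y) ->
  lam < rho R D.
Proof.
move=> w_gt0 lam_ge0 Dw.
(* By finiteness one [lam'] above [lam] serves all vertices; [lam + 1] is the starting value of the
   minimum. *)
pose lam' := \big[Order.min/lam + 1]_x ((\sum_(y | D x y) w y) / w x).
have lam'_gt : lam < lam'.
  apply: lt_bigmin; first by rewrite ltrDl.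
  by move=> x _; rewrite ltr_pdivlMr.
apply: (lt_le_trans lam'_gt); apply: (rho_ge (w := w)).
- by move=> x; apply: ltW.
- by exists x0; rewrite gt_eqF.
- by apply: ltW; apply: le_lt_trans lam'_gt.
- by move=> x; rewrite -ler_pdivlMr // /lam' bigmin_le.
Qed.

(* The slack at z is spread over all vertices by adding to w a small multiple
   of the weight (2 lam)^(- dist z x), which more than compensates itself at
   every vertex except z. *)
Lemma rho_gt (R : realType) (V : finType) (D : rel V) (w : V -> R) (lam : R)
    (z : V) :
    strongly_connected D -> (forall x, 0 < w x) -> 0 < lam ->
    (forall x, lam * w x <= \sum_(y | D x y) w y) ->
    lam * w z < \sum_(y | D z y) w y ->
  lam < rho R D.
Proof.
move=> D_sc w_gt0 lam_gt0 Dw Dwz.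
pose gap := (\sum_(y | D z y) w y) - lam * w z.
have gap_gt0 : 0 < gap by rewrite subr_gt0.
pose c := gap / (2 * lam).
have c_gt0 : 0 < c by rewrite divr_gt0 // mulr_gt0.
pose e x := c * (2 * lam)^-1 ^+ dist D_sc z x.
have e_gt0 x : 0 < e x by rewrite mulr_gt0 // exprn_gt0 // invr_gt0 mulr_gt0.
apply: (@rho_gt_all _ _ _ (fun x => w x + e x) _ z) (ltW lam_gt0) _.
  by move=> x; rewrite addr_gt0.
move=> x; rewrite mulrDr big_split /=.
have [->|xz] := eqVneq x z.
  have ez : lam * e z < gap.
    rewrite /e distxx mulr1 /c invfM mulrCA [_ * lam^-1]mulrC mulVKf ?gt_eqF //.
    by rewrite gtr_pMr // invf_lt1 // ltr1n.
  apply: lt_le_trans (_ : \sum_(y | D z y) w y <= _).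
    by rewrite -ltrBrDl.
  by rewrite lerDl; apply: sumr_ge0 => y _; apply: ltW.
apply: ler_ltD => //; have [y xy dxy] := dist_next D_sc xz.
apply: lt_le_trans (_ : e y <= _); last first.
  by rewrite (bigD1 y) //= lerDl; apply: sumr_ge0 => u _; apply: ltW.
have -> : lam * e x = e y / 2 by rewrite /e dxy exprS; field; rewrite gt_eqF.
by rewrite gtr_pMr // invf_lt1 // ltr1n.
Qed.

(** * The digraphs theta *)

Section Labels.

Variables (V : finType) (D : rel V) (n : nat) (P : rel nat) (f : V -> nat).
Hypothesis V_card : #|V| = n.
Hypothesis f_surj : forall j, (j < n)%N -> exists x, f x = j.
Hypothesis DP : forall x y, D x y = P (f x) (f y).

Let f_inj : injective f.
Proof. by have [] := surjective_label V_card f_surj. Qed.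

Let f_lt x : (f x < n)%N.
Proof. by have [] := surjective_label V_card f_surj. Qed.

(** Decreasing labels lead from any vertex to label 0. Backwards from any vertex, arcs from label
    [j.+1] to [j] are followed up to an out-neighbour of label 0, at the latest label [n - 1]. *)
Lemma simple_strong_of_label :
    (forall i, (i < n)%N -> ~~ P i i) ->
    (forall i, (0 < i < n)%N -> exists2 j, (j < i)%N & P i j) ->
    (forall j, (j < n)%N -> P 0%N j || (j.+1 < n)%N && P j.+1 j) ->
  simple_strong_digraph n D.
Proof.
move=> P_irr P_down P_up; split=> // [x|x y].
  by rewrite DP; apply/negbTE/P_irr.
have [|p fp] := f_surj (j := 0%N); first exact: leq_ltn_trans (f_lt x).
have to_p u : connect D u p.
  have [k] := ubnP (f u); elim: k u => // k IHk u; rewrite ltnS => fu_le.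
  have [fu0|fu_gt0] := posnP (f u).
    by rewrite (_ : u = p) ?connect0 //; apply: f_inj; rewrite fu0 fp.
  have [|j j_lt Puj] := P_down (f u); first by rewrite fu_gt0 f_lt.
  have [|v fv] := f_surj (j := j); first exact: ltn_trans (f_lt u).
  apply: connect_trans (_ : connect D u v) (IHk v _).
    by apply: connect1; rewrite DP fv.
  by rewrite fv; apply: leq_trans fu_le.
have from_p u : connect D p u.
  have [k] := ubnP (n - f u); elim: k u => // k IHk u; rewrite ltnS => fu_ge.
  have /orP[Ppu|/andP[fu_lt Pu]] := P_up _ (f_lt u).
    by apply: connect1; rewrite DP fp.
  have [v fv] := f_surj fu_lt.
  apply: connect_trans (IHk v _) (_ : connect D v u).
    by rewrite fv; have := f_lt u; lia.
  by apply: connect1; rewrite DP fv.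
exact: connect_trans (to_p x) (from_p y).
Qed.

(** The weight [s ^+ d (f x)] is a positive eigenvector for [s^-1], the equation on [s] being the
    condition at label 0; so both weight bounds apply. [d] is kept apart from the label because of
    the twins in theta(1,1,n-4). *)
Lemma rho_label (R : realType) (d : nat -> nat) (i1 i2 : nat) (s : R) :
    0 < s -> (0 < n)%N -> (i1 < n)%N -> (i2 < n)%N -> i1 != i2 ->
    (forall j, (j < n)%N -> P 0%N j = (j == i1) || (j == i2)) ->
    (forall i, (0 < i < n)%N -> exists2 k, (k < n)%N /\ d i = (d k).+1 &
       forall j, (j < n)%N -> P i j = (j == k)) ->
    d 0%N = 0%N -> s ^+ (d i1).+1 + s ^+ (d i2).+1 = 1 ->
  rho R D = s^-1.
Proof.
move=> s_gt0 n_gt0 i1_lt i2_lt i12 P0 Pi d0 s_eq.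
have [p fp] := f_surj n_gt0.
have [[q1 fq1] [q2 fq2]] := (f_surj i1_lt, f_surj i2_lt).
pose w x := s ^+ d (f x).
have w_gt0 x : 0 < w x by rewrite exprn_gt0.
have sumE x : \sum_(y | D x y) w y = s^-1 * w x.
  have [fx0|fx_gt0] := posnP (f x); last first.
    have [|k [k_lt dk] Pk] := Pi (f x); first by rewrite fx_gt0 f_lt.
    have [y fy] := f_surj k_lt.
    rewrite (big_pred1 y) => [|u].
      by rewrite /w dk fy exprS mulKf ?gt_eqF.
    by rewrite DP Pk // -fy (inj_eq f_inj).
  have Dx y : D x y = (y == q1) || (y == q2).
    by rewrite DP fx0 P0 // -fq1 -fq2 !(inj_eq f_inj).
  have q21 : q2 != q1 by rewrite -(inj_eq f_inj) fq1 fq2 eq_sym.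
  rewrite (bigD1 q1) ?Dx ?eqxx //= (big_pred1 q2) => [|y]; last first.
    rewrite Dx; have [->|] := eqVneq y q1.
      by rewrite [RHS]eq_sym (negbTE q21) andbF.
    by rewrite andbT.
  rewrite /w fx0 d0 mulr1 fq1 fq2; apply: (mulfI (lt0r_neq0 s_gt0)).
  by rewrite divff ?gt_eqF // mulrDr -!exprS.
apply/eqP; rewrite eq_le; apply/andP; split.
  apply: (rho_le (w := w)) => // [|x]; last by rewrite sumE.
  by apply/card_gt0P; exists p.
apply: (rho_ge (w := w)) => [x| | |x]; last by rewrite sumE.
- exact: ltW.
- by exists p; rewrite gt_eqF.
- by rewrite invr_ge0 ltW.
Qed.

End Labels.

(** The cases are a path without inner vertices, then the first, inner and last arcs of a path with
    some. Membership in [theta] becomes linear arithmetic. *)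
Lemma mem_path_arcs_iota (m c x y u v : nat) :
  ((u, v) \in path_arcs (x :: iota m c ++ [:: y])) =
  [|| [&& u == x, c == 0%N & v == y], [&& u == x, (0 < c)%N & v == m],
      [&& (m <= u)%N, (u.+1 < m + c)%N & v == u.+1]
    | [&& (0 < c)%N, u.+1 == (m + c)%N & v == y]].
Proof.
elim: c m x => [|c IHc] m x; first by rewrite inE xpair_eqE; lia.
rewrite -[path_arcs _]/((x, m) :: path_arcs (m :: iota m.+1 c ++ [:: y])).
by rewrite inE xpair_eqE IHc; lia.
Qed.

(** Shape obtained when labels are distances to vertex 0, each attained once. On n vertices, [S] is
    [n-1] for the cycle, [n-1, n-2] for theta(0,1,n-3) and [n-1, n-3] for theta(0,2,n-4). *)
Definition descent_rel (S : seq nat) : rel nat :=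
  fun i j => (i == j.+1) || (i == 0%N) && (j \in S).

(* As descent_rel on labels below n, except that n - 1 and n - 2 are twins. *)
Definition twin_descent_rel (n : nat) : rel nat := fun i j =>
  [|| (i == j.+1) && (i < n.-1)%N, (i == n.-1) && (j == n - 3)%N
    | (i == 0%N) && (j \in [:: n.-1; n - 2]%N)].

(* The label of a vertex is its distance to vertex 0, except that the two inner
   vertices of the parallel paths of theta(1,1,n-4), both at distance n - 2, get
   the labels n - 2 and n - 1. *)
Definition theta01_label (n u : nat) : nat :=
  match u with 0 => 0 | 1 => n - 2 | 2 => n.-1 | _ => n - u end%N.

Definition theta02_label (n u : nat) : nat :=
  match u with 0 => 0 | 1 => n - 3 | 2 => n.-1 | 3 => n - 2 | _ => n - u end%N.

Definition theta11_label (n u : nat) : nat :=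
  match u with 0 => 0 | 1 => n - 2 | 2 => n - 3 | 3 => n.-1 | _ => n - u end%N.

Definition dicycle_label (n u : nat) : nat := if u is 0 then 0%N else (n - u)%N.

Lemma theta01E (c : nat) (u v : 'I_(0 + 1 + c.+1 + 2)) :
  theta 0 1 c.+1 u v =
  descent_rel [:: c.+3; c.+2] (theta01_label c.+4 u) (theta01_label c.+4 v).
Proof.
rewrite /theta !mem_cat !mem_path_arcs_iota /descent_rel !inE.
case: u v => [u /= u_lt] [v /= v_lt].
case: u u_lt => [|[|[|u]]] u_lt; case: v v_lt => [|[|[|v]]] v_lt /=; lia.
Qed.

Lemma theta02E (c : nat) (u v : 'I_(0 + 2 + c + 2)) :
  theta 0 2 c u v =
  descent_rel [:: c.+3; c.+1] (theta02_label c.+4 u) (theta02_label c.+4 v).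
Proof.
rewrite /theta !mem_cat !mem_path_arcs_iota /descent_rel !inE.
case: u v => [u /= u_lt] [v /= v_lt].
(* For [c = 0] the third path is a single arc, hence the split on [c]. *)
by case: u u_lt => [|[|[|[|u]]]] u_lt; case: v v_lt => [|[|[|[|v]]]] v_lt /=;
  case: c u_lt v_lt => [|c] u_lt v_lt /=; lia.
Qed.

Lemma theta11E (c : nat) (u v : 'I_(1 + 1 + c + 2)) :
  theta 1 1 c u v =
  twin_descent_rel c.+4 (theta11_label c.+4 u) (theta11_label c.+4 v).
Proof.
rewrite /theta !mem_cat !mem_path_arcs_iota /twin_descent_rel !inE.
case: u v => [u /= u_lt] [v /= v_lt].
by case: u u_lt => [|[|[|[|u]]]] u_lt; case: v v_lt => [|[|[|[|v]]]] v_lt /=;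
  case: c u_lt v_lt => [|c] u_lt v_lt /=; lia.
Qed.

Lemma dicycleE (c : nat) (u v : 'I_c.+4) :
  dicycle c.+4 u v =
  descent_rel [:: c.+3] (dicycle_label c.+4 u) (dicycle_label c.+4 v).
Proof.
rewrite /dicycle /descent_rel !inE; case: u v => [u /= u_lt] [v /= v_lt].
have -> : (u.+1 %% c.+4 = if u == c.+3 then 0 else u.+1)%N.
  by case: eqP => [->|]; [rewrite modnn|move=> ?; rewrite modn_small //; lia].
case: ifP => u_last; case: u u_lt u_last => [|u] u_lt u_last;
  by case: v v_lt => [|v] v_lt /=; lia.
Qed.

Lemma ex_ord (m : nat) (Q : nat -> Prop) :
  (exists2 k, (k < m)%N & Q k) -> exists u : 'I_m, Q u.
Proof. by case=> k k_lt Qk; exists (Ordinal k_lt). Qed.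

Lemma theta01_label_surj (c j : nat) : (j < c.+4)%N ->
  exists u : 'I_(0 + 1 + c.+1 + 2), theta01_label c.+4 u = j.
Proof.
move=> j_lt; apply: (@ex_ord _ (fun k => theta01_label c.+4 k = j)).
have [->|j0] := eqVneq j 0%N; first by exists 0%N.
have [->|j1] := eqVneq j c.+2; first by exists 1%N => //=; lia.
have [->|j2] := eqVneq j c.+3; first by exists 2%N => //=; lia.
exists (c.+4 - j)%N; first lia.
by case E: (c.+4 - j)%N => [|[|[|k]]] /=; lia.
Qed.

Lemma theta02_label_surj (c j : nat) : (j < c.+4)%N ->
  exists u : 'I_(0 + 2 + c + 2), theta02_label c.+4 u = j.
Proof.
move=> j_lt; apply: (@ex_ord _ (fun k => theta02_label c.+4 k = j)).
have [->|j0] := eqVneq j 0%N; first by exists 0%N.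
have [->|j1] := eqVneq j c.+1; first by exists 1%N => //=; lia.
have [->|j2] := eqVneq j c.+3; first by exists 2%N => //=; lia.
have [->|j3] := eqVneq j c.+2; first by exists 3%N => //=; lia.
exists (c.+4 - j)%N; first lia.
by case E: (c.+4 - j)%N => [|[|[|[|k]]]] /=; lia.
Qed.

Lemma theta11_label_surj (c j : nat) : (j < c.+4)%N ->
  exists u : 'I_(1 + 1 + c + 2), theta11_label c.+4 u = j.
Proof.
move=> j_lt; apply: (@ex_ord _ (fun k => theta11_label c.+4 k = j)).
have [->|j0] := eqVneq j 0%N; first by exists 0%N.
have [->|j1] := eqVneq j c.+2; first by exists 1%N => //=; lia.
have [->|j2] := eqVneq j c.+1; first by exists 2%N => //=; lia.
have [->|j3] := eqVneq j c.+3; first by exists 3%N => //=; lia.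
exists (c.+4 - j)%N; first lia.
by case E: (c.+4 - j)%N => [|[|[|[|k]]]] /=; lia.
Qed.

Lemma dicycle_label_surj (n j : nat) : (j < n)%N ->
  exists u : 'I_n, dicycle_label n u = j.
Proof.
move=> j_lt; apply: (@ex_ord _ (fun k => dicycle_label n k = j)).
have [->|j0] := eqVneq j 0%N; first by exists 0%N => //; lia.
exists (n - j)%N; first lia.
by case E: (n - j)%N => [|k] /=; lia.
Qed.

Lemma card_theta01 (c : nat) : #|'I_(0 + 1 + c.+1 + 2)| = c.+4.
Proof. by rewrite card_ord; lia. Qed.

Lemma card_theta02 (c : nat) : #|'I_(0 + 2 + c + 2)| = c.+4.
Proof. by rewrite card_ord; lia. Qed.

Lemma card_theta11 (c : nat) : #|'I_(1 + 1 + c + 2)| = c.+4.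
Proof. by rewrite card_ord; lia. Qed.

Lemma simple_strong_dicycle (c : nat) :
  simple_strong_digraph c.+4 (dicycle c.+4).
Proof.
apply: (simple_strong_of_label (card_ord _)
          (@dicycle_label_surj _) (@dicycleE c)).
- by move=> i; rewrite /descent_rel !inE; lia.
- by move=> i i_gt0; exists i.-1; rewrite /descent_rel; lia.
- by move=> j; rewrite /descent_rel !inE; lia.
Qed.

Lemma simple_strong_theta01 (c : nat) :
  simple_strong_digraph c.+4 (theta 0 1 c.+1).
Proof.
apply: (simple_strong_of_label (card_theta01 c)
          (@theta01_label_surj c) (@theta01E c)).
- by move=> i; rewrite /descent_rel !inE; lia.
- by move=> i i_gt0; exists i.-1; rewrite /descent_rel; lia.
- by move=> j; rewrite /descent_rel !inE; lia.
Qed.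

Lemma simple_strong_theta02 (c : nat) :
  simple_strong_digraph c.+4 (theta 0 2 c).
Proof.
apply: (simple_strong_of_label (card_theta02 c)
          (@theta02_label_surj c) (@theta02E c)).
- by move=> i; rewrite /descent_rel !inE; lia.
- by move=> i i_gt0; exists i.-1; rewrite /descent_rel; lia.
- by move=> j; rewrite /descent_rel !inE; lia.
Qed.

Lemma simple_strong_theta11 (c : nat) :
  simple_strong_digraph c.+4 (theta 1 1 c).
Proof.
apply: (simple_strong_of_label (card_theta11 c)
          (@theta11_label_surj c) (@theta11E c)).
- by move=> i; rewrite /twin_descent_rel !inE; lia.
- move=> i i_gt0; rewrite /twin_descent_rel.
  have [->|i_lt] := eqVneq i c.+3.
    by exists c.+1 => //; rewrite !inE; lia.
  by exists i.-1; lia.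
- by move=> j; rewrite /twin_descent_rel !inE; lia.
Qed.

(** * Spectral radii of the cycle and the theta digraphs *)

Lemma rho_dicycle_le1 (R : realType) (c : nat) : rho R (dicycle c.+4) <= 1.
Proof.
apply: (rho_le (w := fun=> 1)) => [|//|x]; first by rewrite card_ord.
rewrite mulr1 (big_pred1 (Ordinal (ltn_pmod x.+1 (ltn0Sn c.+3)))) // => y.
Qed.

Lemma rho_theta01 (R : realType) (c : nat) (s : R) :
  0 < s -> s ^+ c.+4 + s ^+ c.+3 = 1 -> rho R (theta 0 1 c.+1) = s^-1.
Proof.
move=> s_gt0 s_eq.
apply: (rho_label (card_theta01 c) (@theta01_label_surj c) (@theta01E c)
          (d := id) (i1 := c.+3) (i2 := c.+2)) => //; try lia.
- by move=> j j_lt; rewrite /descent_rel !inE.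
- move=> i i_gt0; exists i.-1; first by split; lia.
  by move=> j j_lt; rewrite /descent_rel; lia.
Qed.

Lemma rho_theta02 (R : realType) (c : nat) (s : R) :
  0 < s -> s ^+ c.+4 + s ^+ c.+2 = 1 -> rho R (theta 0 2 c) = s^-1.
Proof.
move=> s_gt0 s_eq.
apply: (rho_label (card_theta02 c) (@theta02_label_surj c) (@theta02E c)
          (d := id) (i1 := c.+3) (i2 := c.+1)) => //; try lia.
- by move=> j j_lt; rewrite /descent_rel !inE.
- move=> i i_gt0; exists i.-1; first by split; lia.
  by move=> j j_lt; rewrite /descent_rel; lia.
Qed.

Lemma rho_theta11 (R : realType) (c : nat) (s : R) :
  0 < s -> s ^+ c.+3 + s ^+ c.+3 = 1 -> rho R (theta 1 1 c) = s^-1.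
Proof.
move=> s_gt0 s_eq.
(* The twins, labelled c+2 and c+3, are both at distance c+2, so distance is the label truncated at
   c+2. *)
apply: (rho_label (card_theta11 c) (@theta11_label_surj c) (@theta11E c)
          (d := minn c.+2) (i1 := c.+3) (i2 := c.+2)) => //; try lia.
- by move=> j j_lt; rewrite /twin_descent_rel !inE; lia.
- move=> i i_gt0; exists (if i == c.+3 then c.+1 else i.-1).
    by case: ifP => ?; split; lia.
  by move=> j j_lt; rewrite /twin_descent_rel; case: ifP => ?; lia.
- by rewrite (minn_idPl _) // minnn.
Qed.

(** Intermediate values of X^a + X^b - 1, which is -1 at 0 and 1 at 1. The roots are the reciprocals
    of the theta radii. *)
Lemma ex_expr_add_expr_eq1 (R : realType) (a b : nat) :
  (0 < a)%N -> (0 < b)%N -> exists2 s : R, 0 < s < 1 & s ^+ a + s ^+ b = 1.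
Proof.
move=> a_gt0 b_gt0.
have [||s /andP[s_ge0 s_le1]] := @poly_ivt R ('X^a + 'X^b - 1%:P) 0 1.
- exact: ler01.
- rewrite !hornerE !expr0n !expr1n (gtn_eqF a_gt0) (gtn_eqF b_gt0) /=.
  by apply/andP; split; lra.
rewrite /root !hornerE subr_eq0 => /eqP s_eq.
exists s => //; rewrite !lt_neqAle s_ge0 s_le1 !andbT.
apply/andP; split; apply/eqP => s_val; move: s_eq.
  by rewrite -s_val !expr0n (gtn_eqF a_gt0) (gtn_eqF b_gt0) /=; lra.
by rewrite s_val !expr1n; lra.
Qed.

(** * All other digraphs *)

Section OutSums.

Variables (R : realType) (V : finType) (D : rel V) (w : V -> R).
Hypothesis w_gt0 : forall x, 0 < w x.

Lemma le_sum_out1 x y : D x y -> w y <= \sum_(u | D x u) w u.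
Proof.
by move=> xy; rewrite (bigD1 y) //= lerDl; apply: sumr_ge0 => u _; apply: ltW.
Qed.

Lemma le_sum_out2 x y z :
  D x y -> D x z -> y != z -> w y + w z <= \sum_(u | D x u) w u.
Proof.
move=> xy xz yz; rewrite (bigD1 y) //= lerD2l (bigD1 z) /=; last first.
  by rewrite xz eq_sym.
by rewrite lerDl; apply: sumr_ge0 => u _; apply: ltW.
Qed.

Lemma lt_sum_out1 x y z :
  D x y -> D x z -> y != z -> w y < \sum_(u | D x u) w u.
Proof.
by move=> xy xz /(le_sum_out2 xy xz); apply: lt_le_trans; rewrite ltrDl.
Qed.

Lemma lt_sum_out2 x y z t : D x y -> D x z -> D x t -> y != z -> t != y ->
  t != z -> w y + w z < \sum_(u | D x u) w u.
Proof.
move=> xy xz xt yz ty tz; rewrite (bigD1 y) //= ltrD2l (bigD1 z) /=; last first.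
  by rewrite xz eq_sym.
rewrite (bigD1 t) /=; last by rewrite xt ty tz.
by rewrite ltrDl ltr_wpDr //; apply: sumr_ge0 => u _; apply: ltW.
Qed.

End OutSums.

(** * Digraphs on n = m + 4 vertices against the radius [s^-1] of theta(0,2,n-4) *)

Section NonThetaBound.

Variables (R : realType) (m : nat) (s : R).
Hypotheses (s_gt0 : 0 < s) (s_lt1 : s < 1) (s_eq : s ^+ m.+4 + s ^+ m.+2 = 1).

Variables (V : finType) (D : rel V).
Hypotheses (V_card : #|V| = m.+4) (D_irr : irreflexive D)
  (D_sc : strongly_connected D).

Let d := dist D_sc.

Let sV : s^-1 = s ^+ m.+3 + s ^+ m.+1.
Proof.
apply: (mulfI (lt0r_neq0 s_gt0)).
by rewrite divff ?gt_eqF // mulrDr -!exprS s_eq.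
Qed.

(** For s <= 1/2 both powers in [s_eq] would be at most 1/4. *)
Let s_gt_half : 1 < 2 * s.
Proof.
have s_le1 := ltW s_lt1; have s_ge0 := ltW s_gt0.
rewrite ltNge; apply/negP => s_half.
have s4 : s ^+ m.+4 <= s ^+ 2 by rewrite ler_wiXn2l.
have s2 : s ^+ m.+2 <= s ^+ 2 by rewrite ler_wiXn2l.
have : s ^+ 2 <= s * 2^-1 by rewrite expr2 ler_wpM2l //; lra.
move: s4 s2 s_eq; set a := s ^+ m.+4; set b := s ^+ m.+2; lra.
Qed.

Let d_lt p x : (d p x < m.+4)%N.
Proof. by rewrite -V_card; apply: dist_lt_card. Qed.

Let d_ge p x y : D x y -> (d p x <= (d p y).+1)%N.
Proof. exact: dist_arc. Qed.

Lemma dist_bij p q : d p q = m.+3 ->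
  (forall j, (j < m.+4)%N -> exists x, d p x = j) /\ injective (d p).
Proof.
move=> dq; have d_surj j : (j < m.+4)%N -> exists x, d p x = j.
  by move=> j_lt; apply: (@dist_surj _ _ D_sc p q); rewrite -/(d p q) dq.
by split=> //; have [] := surjective_label V_card d_surj.
Qed.

(** Each arc one level down is present: [dist_next] gives an arc to that level, whose only vertex is
    its head. *)
Lemma descent_of_dist p (S : seq nat) :
    injective (d p) -> (forall y, D p y = (d p y \in S)) ->
    (forall x y, x != p -> D x y -> d p x = (d p y).+1) ->
  forall x y, D x y = descent_rel S (d p x) (d p y).
Proof.
move=> d_inj Dp Dx x y; rewrite /descent_rel.
have [->|xp] := eqVneq x p; first by rewrite Dp /d distxx.
rewrite [d p x == 0%N]dist_eq0 (negbTE xp) orbF.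
apply/idP/eqP => [|dxy]; first exact: Dx.
have [z xz dxz] := dist_next D_sc xp.
suff -> : y = z by [].
by apply: d_inj; apply: succn_inj; rewrite -dxy; apply: dxz.
Qed.

(** By [sV] the weights of [q1] and [q2] suffice at [p]. Slack comes from a smaller distance of [q1]
    or [q2], a third out-neighbour of [p], or an arc elsewhere that does not descend by one level;
    without slack only theta(0,2,n-4) is left. *)
Lemma rho_gt_or_theta02 p q1 q2 :
    q1 != q2 -> D p q1 -> D p q2 -> (d p q1 <= m.+1)%N ->
  s^-1 < rho R D \/ digraph_iso D (theta 0 2 m).
Proof.
move=> q12 pq1 pq2 dq1.
have s_le1 := ltW s_lt1; have s_ge0 := ltW s_gt0.
pose w x := s ^+ d p x.
have w_gt0 x : 0 < w x by rewrite exprn_gt0.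
have wp : w p = 1 by rewrite /w /d distxx.
have w_next x y : d p x = (d p y).+1 -> s^-1 * w x = w y.
  by rewrite /w => ->; rewrite exprS mulKf ?gt_eqF.
have dq2 : (d p q2 <= m.+3)%N by rewrite -ltnS.
have wq1 : s ^+ m.+1 <= w q1 by rewrite ler_wiXn2l.
have wq2 : s ^+ m.+3 <= w q2 by rewrite ler_wiXn2l.
have w_sub x : s^-1 * w x <= \sum_(y | D x y) w y.
  have [->|xp] := eqVneq x p.
    apply: le_trans (le_sum_out2 w_gt0 pq1 pq2 q12).
    by rewrite wp mulr1 sV addrC lerD.
  have [y xy dxy] := dist_next D_sc xp.
  by rewrite (w_next _ _ dxy) le_sum_out1.
have strict z : s^-1 * w z < \sum_(y | D z y) w y -> s^-1 < rho R D.
  by apply: rho_gt => //; rewrite invr_gt0.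
move: dq1; rewrite leq_eqVlt => /predU1P[dq1|dq1]; last first.
  left; apply: (strict p); apply: lt_le_trans (le_sum_out2 w_gt0 pq1 pq2 q12).
  by rewrite wp mulr1 sV addrC ltr_leD // ltr_iXn2l.
move: dq2; rewrite leq_eqVlt => /predU1P[dq2|dq2]; last first.
  left; apply: (strict p); apply: lt_le_trans (le_sum_out2 w_gt0 pq1 pq2 q12).
  by rewrite wp mulr1 sV addrC ler_ltD // ltr_iXn2l.
have [d_surj d_inj] := dist_bij dq2.
have [/existsP[t /and3P[pt tq1 tq2]]|no3] :=
    boolP [exists t, [&& D p t, t != q1 & t != q2]].
  left; apply: (strict p).
  apply: le_lt_trans (lt_sum_out2 w_gt0 pq1 pq2 pt q12 tq1 tq2).
  by rewrite wp mulr1 sV addrC lerD.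
have [/existsP[x /existsP[y /and3P[xp xy dxy]]]|no2] :=
    boolP [exists x, exists y, [&& x != p, D x y & d p x != (d p y).+1]].
  left; apply: (strict x); have [z xz dxz] := dist_next D_sc xp.
  rewrite (w_next _ _ dxz); apply: lt_sum_out1 xz xy _ => //.
  by apply: contra dxy => /eqP<-; apply/eqP.
right; apply: (iso_of_labels V_card (card_theta02 m) d_surj
                 (@theta02_label_surj m) _ (@theta02E m)).
apply: (descent_of_dist d_inj) => [y|x y xp xy].
  rewrite !inE -dq2 -dq1 !(inj_eq d_inj); apply/idP/idP => [py|].
    apply: contraR no3 => y_neq; apply/existsP; exists y.
    by move: y_neq; rewrite py negb_or andbC.
  by case/orP=> /eqP->.
apply/eqP; apply: contraR no2 => dxy; apply/existsP; exists x.
by apply/existsP; exists y; rewrite xp xy.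
Qed.

(** The levels of the distance to [p] are singletons. Outside theta(0,1,n-3) some x other than [p]
    has an arc not descending by one level, and [far] forces it to go from level 1 to [q2]. *)
Lemma rho_gt_or_theta01 p q1 q2 :
    (forall p q1 q2, q1 != q2 -> D p q1 -> D p q2 -> (m.+2 <= d p q1)%N) ->
    q1 != q2 -> D p q1 -> D p q2 -> d p q2 = m.+3 ->
  s^-1 < rho R D \/ digraph_iso D (theta 0 1 m.+1).
Proof.
move=> far q12 pq1 pq2 dq2.
have s_le1 := ltW s_lt1; have s_ge0 := ltW s_gt0.
have [d_surj d_inj] := dist_bij dq2.
have d_of_out t u :
    t != u -> D p t -> D p u -> (d p t == m.+2) || (d p t == m.+3).
  by move=> tu pt pu; move: (far _ _ _ tu pt pu) (d_lt p t); clear; lia.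
have dq1 : d p q1 = m.+2.
  have /orP[/eqP //|] := d_of_out _ _ q12 pq1 pq2.
  by rewrite -dq2 (inj_eq d_inj) (negbTE q12).
have [/existsP[x /existsP[y /and3P[xp xy dxy]]]|no2] :=
    boolP [exists x, exists y, [&& x != p, D x y & d p x != (d p y).+1]];
  last first.
  right; apply: (iso_of_labels V_card (card_theta01 m) d_surj
                   (@theta01_label_surj m) _ (@theta01E m)).
  apply: (descent_of_dist d_inj) => [y|x y xp xy].
    rewrite !inE; apply/idP/idP => [py|].
      have [->|yq1] := eqVneq y q1; first by rewrite dq1 eqxx orbT.
      by rewrite orbC; apply: d_of_out yq1 py pq1.
    by rewrite -dq2 -dq1 !(inj_eq d_inj) => /orP[] /eqP->.
  apply/eqP; apply: contraR no2 => dxy; apply/existsP; exists x.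
  by apply/existsP; exists y; rewrite xp xy.
left; have [z xz dxz] := dist_next D_sc xp.
have dx_gt0 : (0 < d p x)%N by rewrite dist_gt0.
have yz : y != z by apply: contra dxy => /eqP->; apply/eqP.
have dx_le : (d p x <= d p y)%N.
  by have := d_ge p xy; rewrite leq_eqVlt (negbTE dxy).
have x_alone u : d p u = d p x -> u = x by apply: d_inj.
(* m+2 <= d x y <= d p y - d p x, where d p y <= m+3 and d p x >= 1: equality holds throughout. *)
have y_near := leq_trans (far _ _ _ yz xy xz) (dist_le_sub x_alone dx_le).
have dx : d p x = 1%N.
  by move: dx_gt0 y_near (d_lt p y); rewrite -/(d p y) -/(d p x); clear; lia.
have yq2 : y = q2.
  apply: d_inj; rewrite dq2.
  by move: dx_gt0 y_near (d_lt p y); rewrite -/(d p y) -/(d p x); clear; lia.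
have zp : z = p.
  apply/eqP; rewrite -(dist_eq0 D_sc).
  by move: dxz; rewrite -/(d p x) dx => -[<-].
(* w satisfies the eigenvalue equations for t on theta(0,1,n-3) together with
   the arc x -> q2, except at x, where the inequality is strict as t < 2. *)
pose w u := if u == p then s ^+ m.+3 + s ^+ m.+2 else s ^+ (d p u).-1.
have w_gt0 u : 0 < w u.
  by rewrite /w; case: ifP => _; rewrite ?addr_gt0 ?exprn_gt0.
have wE u k : d p u = k.+1 -> w u = s ^+ k.
  by move=> du; rewrite /w -(dist_eq0 D_sc) -/(d p u) du.
have sVS k : s^-1 * s ^+ k.+1 = s ^+ k by rewrite exprS mulKf ?gt_eqF.
have strict : s^-1 * w x < \sum_(u | D x u) w u.
  apply: lt_le_trans (le_sum_out2 w_gt0 xy xz yz).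
  rewrite (wE x _ dx) mulr1 yq2 (wE q2 _ dq2) zp /w eqxx sV.
  (* After cancelling s^(m+3) there remains s^(m+1) < 2 s^(m+2). *)
  have : s ^+ m.+1 * 1 < s ^+ m.+1 * (2 * s) by rewrite ltr_pM2l ?exprn_gt0.
  rewrite mulr1 mulrCA -exprSr; lra.
apply: (rho_gt D_sc w_gt0 _ _ strict); first by rewrite invr_gt0.
move=> u; have [->|ux] := eqVneq u x; first exact: ltW.
have [->|up] := eqVneq u p.
  apply: le_trans (le_sum_out2 w_gt0 pq1 pq2 q12).
  by rewrite (wE q1 _ dq1) (wE q2 _ dq2) {1}/w eqxx mulrDr !sVS addrC.
have [v uv duv] := dist_next D_sc up; rewrite -/(d p u) -/(d p v) in duv.
case Ev: (d p v) duv => [|k] duv.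
  by case/eqP: ux; apply: d_inj; rewrite duv dx.
by rewrite (wE u _ duv) sVS -(wE v _ Ev) le_sum_out1.
Qed.

(** Level m+2 consists of [q1] and [q2], and each lower level is a singleton. [far] then excludes
    every arc outside theta(1,1,n-4). *)
Lemma rho_gt_or_theta11 p q1 q2 :
    (forall p q1 q2, q1 != q2 -> D p q1 -> D p q2 -> d p q1 = m.+2) ->
    q1 != q2 -> D p q1 -> D p q2 ->
  digraph_iso D (theta 1 1 m).
Proof.
move=> far q12 pq1 pq2.
have dq1 := far _ _ _ q12 pq1 pq2.
have dq2 : d p q2 = m.+2 by apply: far pq2 pq1; rewrite eq_sym.
(* The free label m+3 breaks the tie between [q1] and [q2]. *)
pose f x := if x == q2 then m.+3 else d p x.
have f_surj j : (j < m.+4)%N -> exists x, f x = j.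
  rewrite ltnS leq_eqVlt => /predU1P[->|j_lt].
    by exists q2; rewrite /f eqxx.
  have [|y dy] := @dist_surj _ _ D_sc p q2 j; first by rewrite -/(d p q2) dq2.
  have [yq2|yq2] := eqVneq y q2; last by exists y; rewrite /f (negbTE yq2).
  by exists q1; rewrite /f (negbTE q12) dq1 -dq2 -yq2.
have [f_inj f_lt] := surjective_label V_card f_surj.
have fq2 : f q2 = m.+3 by rewrite /f eqxx.
have d_le x : (d p x <= m.+2)%N.
  have [->|xq2] := eqVneq x q2; first by rewrite dq2.
  have := f_lt x; rewrite ltnS leq_eqVlt => /predU1P[|].
    by rewrite -fq2 => /f_inj xq2'; rewrite xq2' eqxx in xq2.
  by rewrite /f (negbTE xq2).
have d_alone x y : (d p x <= m.+1)%N -> d p y = d p x -> y = x.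
  move=> dx dyx; apply: f_inj; rewrite /f.
  have [xq2|_] := eqVneq x q2; first by rewrite xq2 dq2 ltnn in dx.
  have [yq2|//] := eqVneq y q2.
  by rewrite yq2 dq2 in dyx; rewrite -dyx ltnn in dx.
have d_last x : d p x = m.+2 -> x != q2 -> x = q1.
  by move=> dx xq2; apply: f_inj; rewrite /f (negbTE xq2) (negbTE q12) dx dq1.
have Dp y : D p y = (y == q1) || (y == q2).
  apply/idP/orP => [py|[]/eqP-> //].
  have [->|yq2] := eqVneq y q2; first by right.
  by left; apply/eqP; apply: d_last => //; apply: far yq2 py pq2.
have Dx x y : x != p -> D x y -> d p x = (d p y).+1.
  move=> xp xy; apply/eqP; apply: contraT => dxy.
  have [z xz dxz] := dist_next D_sc xp; rewrite -/(d p x) -/(d p z) in dxz.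
  have yz : y != z by apply: contra dxy => /eqP->; apply/eqP.
  have dx_le : (d p x <= d p y)%N.
    by have := d_ge p xy; rewrite leq_eqVlt (negbTE dxy).
  have dx_gt0 : (0 < d p x)%N by rewrite dist_gt0.
  have dxy_far := far _ _ _ yz xy xz.
  have xy_neq : x != y by apply: contraL xy => /eqP<-; rewrite D_irr.
  (* If [x] is alone on its level, d x y <= d p y - d p x <= m+1, against [far]. *)
  have [dx|dx] := leqP (d p x) m.+1.
    have := dist_le_sub (fun u => @d_alone x u dx) dx_le.
    rewrite -/(d x y) dxy_far; move: dx_gt0 (d_le y).
    by rewrite -/(d p y) -/(d p x); clear; lia.
  (* Now [x] and [y] are the twins. The vertex [v] after [y] on a geodesic to [x] lies on level m+1
     or m+2, so it is [z], [x] or [y]. But [v] is at distance m+1 from [x], whereas [z] is at m+2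
     and [x] at 0, and [y] has no loop. *)
  have dx_eq : d p x = m.+2 by apply/eqP; rewrite eqn_leq d_le.
  have dy_eq : d p y = m.+2 by apply/eqP; rewrite eqn_leq d_le -dx_eq.
  have dxz_far : d x z = m.+2 by apply: far xz xy; rewrite eq_sym.
  have yx : y != x by rewrite eq_sym.
  have [v yv dv] := dist_next D_sc yx.
  rewrite -/(d x y) -/(d x v) dxy_far in dv.
  have v_lvl : (m.+1 <= d p v)%N by have := d_ge p yv; rewrite dy_eq.
  move: v_lvl; rewrite leq_eqVlt => /predU1P[dv1|dv2].
    have vz : v = z.
      move: dxz; rewrite dx_eq dv1 => -[dvz].
      by apply: d_alone; rewrite -dvz -?dv1.
    by move: dv; rewrite vz dxz_far => /eqP; rewrite eqn_leq ltnn andbF.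
  have dv_eq : d p v = m.+2 by apply/eqP; rewrite eqn_leq d_le.
  have vx : v != x by apply: contra_eqN dv => /eqP->; rewrite /d distxx.
  have vy : v != y by apply: contraL yv => /eqP->; rewrite D_irr.
  have two u : d p u = m.+2 -> (u == q1) || (u == q2).
    move=> du; have [->|uq2] := eqVneq u q2; first by rewrite orbT.
    by rewrite (d_last u du uq2) eqxx.
  move: (two _ dx_eq) (two _ dy_eq) (two _ dv_eq) xy_neq vx vy.
  by move=> /orP[]/eqP-> /orP[]/eqP-> /orP[]/eqP->; rewrite ?eqxx.
apply: (iso_of_labels V_card (card_theta11 m) f_surj
          (@theta11_label_surj m) _ (@theta11E m)) => x y.
have [->|xp] := eqVneq x p.
  have pq2' : p == q2 = false.
    by apply: contra_eqF dq2 => /eqP<-; rewrite /d distxx.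
  have fp : f p = 0%N by rewrite /f pq2' /d distxx.
  rewrite Dp -!(inj_eq f_inj) fp fq2 /f (negbTE q12) dq1 /twin_descent_rel.
  by rewrite !inE; clear; lia.
have -> : D x y = (d p x == (d p y).+1).
  apply/idP/eqP => [|dxy]; first exact: Dx.
  have [z xz dxz] := dist_next D_sc xp; rewrite -/(d p x) -/(d p z) in dxz.
  have dzy : d p y = d p z by apply: succn_inj; rewrite -dxy.
  by rewrite (d_alone z y) //; have := d_le x; rewrite dxz.
move: (d_le x) (d_le y); have : (0 < d p x)%N by rewrite dist_gt0.
rewrite /f /twin_descent_rel !inE.
by have [->|xq2] := eqVneq x q2; have [->|yq2] := eqVneq y q2;
  rewrite ?dq2; clear; lia.
Qed.

(** Along the successor map [nx] from [q], the distance to [p] drops by one until [p], after which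
    the orbit returns to [q]. By strong connectivity this orbit is everything, so distances to [p]
    are distinct. *)
Lemma dicycle_of_unary :
  (forall p q1 q2, D p q1 -> D p q2 -> q1 = q2) -> digraph_iso D (dicycle m.+4).
Proof.
move=> unary.
have /card_gt1P[p [q0 [_ _ pq0]]] : (1 < #|V|)%N by rewrite V_card.
have /choice[nx nxP] : forall x, exists y, D x y.
  move=> x; have [<-|xp] := eqVneq p x.
    by have [y py _] := dist_next D_sc pq0; exists y.
  by have [|y xy _] := @dist_next _ _ D_sc p x; [rewrite eq_sym|exists y].
have nx_eq x y : D x y -> y = nx x by move=> xy; apply: unary xy (nxP x).
have d_nx x : x != p -> d p x = (d p (nx x)).+1.
  by move=> /(dist_next D_sc)[y /nx_eq<-].
pose q := nx p.
have d_iter k : (k <= d p q)%N -> (k + d p (iter k nx q) = d p q)%N.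
  elim: k => // k IHk k_lt; have := IHk (ltnW k_lt) => dk.
  have /d_nx : iter k nx q != p by rewrite -(dist_gt0 D_sc) -/(d p _); lia.
  by rewrite iterS; lia.
have orbit_path t : forall k, (k <= d p q)%N -> path D (iter k nx q) t ->
    exists2 k', (k' <= d p q)%N & last (iter k nx q) t = iter k' nx q.
  elim: t => [|y t IHt] k k_le /=; first by exists k.
  (* Index d p q is [p] itself; the next vertex is [q], so the index restarts at 0. *)
  case/andP => /nx_eq->; move: k_le; rewrite leq_eqVlt => /predU1P[k_eq|k_lt].
    have -> : iter k nx q = p.
      by apply/eqP; rewrite -(dist_eq0 D_sc) -/(d p _); have := d_iter k; lia.
    exact: (IHt 0%N).
  by rewrite -iterS; apply: IHt.
have orbitP x : exists2 k, (k <= d p q)%N & x = iter k nx q.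
  by have /connectP[t qt ->] := D_sc q x; apply: (orbit_path t 0%N).
have d_inj : injective (d p).
  move=> x y; have [k k_le ->] := orbitP x; have [l l_le ->] := orbitP y => dkl.
  by congr iter; have := d_iter k k_le; have := d_iter l l_le; lia.
have d_le x : (d p x < (d p q).+1)%N.
  by have [k k_le ->] := orbitP x; have := d_iter k k_le; lia.
have dq : d p q = m.+3.
  apply/eqP; rewrite eqn_leq -ltnS d_lt /= -ltnS -V_card -[leqRHS]card_ord.
  apply: (@leq_card _ _ (fun x => Ordinal (d_le x))) => x y [].
  exact: d_inj.
have [d_surj _] := dist_bij dq.
apply: (iso_of_labels V_card (card_ord _) d_surj
          (@dicycle_label_surj _) _ (@dicycleE m)).
apply: (descent_of_dist d_inj) => [y|x y xp /nx_eq->]; last exact: d_nx.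
rewrite inE -dq (inj_eq d_inj); apply/idP/eqP => [/nx_eq //|->]; exact: nxP.
Qed.

(** Cases on out-neighbours of branching vertices: one at distance at most n-3; else one at n-1;
    else all at n-2; else no branching. *)
Lemma rho_gt_or_iso :
  [\/ s^-1 < rho R D, digraph_iso D (dicycle m.+4),
      digraph_iso D (theta 0 1 m.+1) |
      digraph_iso D (theta 1 1 m) \/ digraph_iso D (theta 0 2 m)].
Proof.
have [[p [q1 [q2 [q12 pq1 pq2 dq1]]]]|no_near] := pselect (exists p q1 q2,
    [/\ q1 != q2, D p q1, D p q2 & (d p q1 <= m.+1)%N]).
  have [?|?] := rho_gt_or_theta02 q12 pq1 pq2 dq1; first exact: Or41.
  by apply: Or44; right.
have far p q1 q2 : q1 != q2 -> D p q1 -> D p q2 -> (m.+2 <= d p q1)%N.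
  move=> q12 pq1 pq2; rewrite ltnNge; apply/negP => dq1.
  by apply: no_near; exists p, q1, q2.
have [[p [q1 [q2 [q12 pq1 pq2 dq2]]]]|no_last] := pselect (exists p q1 q2,
    [/\ q1 != q2, D p q1, D p q2 & d p q2 = m.+3]).
  have [?|?] := rho_gt_or_theta01 far q12 pq1 pq2 dq2; first exact: Or41.
  exact: Or43.
have far_eq p q1 q2 : q1 != q2 -> D p q1 -> D p q2 -> d p q1 = m.+2.
  move=> q12 pq1 pq2; apply/eqP; rewrite eqn_leq (far _ _ _ q12 pq1 pq2) andbT.
  have := d_lt p q1; rewrite ltnS leq_eqVlt => /predU1P[dq1|//].
  by case: no_last; exists p, q2, q1; rewrite eq_sym.
have [[p [q1 [q2 [q12 pq1 pq2]]]]|unary] := pselect (exists p q1 q2,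
    [/\ q1 != q2, D p q1 & D p q2]).
  by apply: Or44; left; apply: rho_gt_or_theta11 far_eq q12 pq1 pq2.
apply: Or42; apply: dicycle_of_unary => p q1 q2 pq1 pq2.
apply/eqP; apply: contra_notT unary => q12.
by exists p, q1, q2.
Qed.

End NonThetaBound.

Theorem theorem7p3 (R : realType) (n : nat) (hn : (4 <= n)%N) :
  [/\ simple_strong_digraph n (dicycle n),
      simple_strong_digraph n (theta 0 1 (n - 3)),
      simple_strong_digraph n (theta 1 1 (n - 4))
    & simple_strong_digraph n (theta 0 2 (n - 4))] /\
  [/\ rho R (dicycle n) < rho R (theta 0 1 (n - 3)),
      rho R (theta 0 1 (n - 3)) < rho R (theta 1 1 (n - 4)),
      rho R (theta 1 1 (n - 4)) < rho R (theta 0 2 (n - 4))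
    & forall (V : finType) (D : rel V),
        simple_strong_digraph n D ->
        ~ digraph_iso D (dicycle n) ->
        ~ digraph_iso D (theta 0 1 (n - 3)) ->
        ~ digraph_iso D (theta 1 1 (n - 4)) ->
        ~ digraph_iso D (theta 0 2 (n - 4)) ->
        rho R (theta 0 2 (n - 4)) < rho R D].
Proof.
have [c ->] : exists c, n = c.+4 by exists (n - 4)%N; lia.
have -> : (c.+4 - 3 = c.+1)%N by lia.
have -> : (c.+4 - 4 = c)%N by lia.
(* [x], [y], [z] are the reciprocals of the three theta radii in increasing order of radius, so the
   aim is z < y < x < 1. *)
have [x /andP[x_gt0 x_lt1] x_eq] :=
  @ex_expr_add_expr_eq1 R c.+4 c.+3 isT isT.
have [y /andP[y_gt0 y_lt1] y_eq] :=
  @ex_expr_add_expr_eq1 R c.+3 c.+3 isT isT.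
have [z /andP[z_gt0 z_lt1] z_eq] :=
  @ex_expr_add_expr_eq1 R c.+4 c.+2 isT isT.
have mono a b k : 0 < a -> a <= b -> a ^+ k <= b ^+ k :> R.
  by move=> a_gt0 ab; rewrite lerXn2r // nnegrE ?ltW // (lt_le_trans a_gt0).
(* If x <= y, then 1 = x^n + x^(n-1) <= y^n + y^(n-1) < 2 y^(n-1) = 1. *)
have yx : y < x.
  rewrite ltNge; apply/negP => xy.
  have := mono _ _ c.+4 x_gt0 xy; have := mono _ _ c.+3 x_gt0 xy.
  have : y ^+ c.+4 < y ^+ c.+3 by rewrite ltr_iXn2l.
  by lra.
(* If y <= z, then y^n + y^(n-2) <= 1 = 2 y^(n-1), against y^(n-2) (1 - y)^2 > 0. *)
have zy : z < y.
  rewrite ltNge; apply/negP => yz.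
  have := mono _ _ c.+2 y_gt0 yz.
  have := mono _ _ c.+4 y_gt0 yz.
  have : 0 < y ^+ c.+2 * (1 - y) ^+ 2.
    by rewrite mulr_gt0 ?exprn_gt0 // subr_gt0.
  have -> : y ^+ c.+2 * (1 - y) ^+ 2 =
      y ^+ c.+4 + y ^+ c.+2 - (y ^+ c.+3 + y ^+ c.+3).
    by rewrite !exprS; ring.
  lra.
rewrite (rho_theta01 x_gt0 x_eq) (rho_theta11 y_gt0 y_eq).
rewrite (rho_theta02 z_gt0 z_eq).
split; first split.
- exact: simple_strong_dicycle.
- exact: simple_strong_theta01.
- exact: simple_strong_theta11.
- exact: simple_strong_theta02.
split; rewrite ?ltf_pV2 //.
  by apply: le_lt_trans (rho_dicycle_le1 R c) _; rewrite invf_gt1.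
move=> V D [V_card D_irr D_sc] not_cycle not01 not11 not02.
by have [|/not_cycle|/not01|[/not11|/not02]] :=
  rho_gt_or_iso z_gt0 z_lt1 z_eq V_card D_irr D_sc.
Qed.
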